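(* Let \[ \theta(t)=\sum_{k=0}^\infty(-1)^{s(k)}\varphi(t-2k-1),\qquad t\in\mathbb{R}, \] where $s(k)$ denotes the sum of the digits of $k$ when written in base $2$. Then: (a) $\theta$ is an infinitely differentiable function on $\mathbb{R}$. (b) $\theta'(t)=2\,\theta(2t)$ for all $t\in\mathbb{R}$. (c) For $t\in[-1,1]$ and every integer $k\ge 0$, the $k$-th derivative of $\varphi$ satisfies $\varphi^{(k)}(t)=2^{\binom{k+1}{2}}\,\theta(2^kt+2^k)$.
   Context: $\varphi\colon\mathbb{R}\to\mathbb{R}$ denotes the unique infinitely differentiable function with compact support such that $\operatorname{supp}(\varphi)=[-1,1]$, $\varphi(t)>0$ for all $t\in(-1,1)$, $\varphi(0)=1$, and $\varphi'(t)=2\bigl(\varphi(2t+1)-\varphi(2t-1)\bigr)$ for all $t\in\mathbb{R}$. The sum defining $\theta$ is locally finite since $\varphi$ vanishes outside $[-1,1]$. *)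

(* Defs.v *)
From Stdlib Require Import Reals List Rtopology.
From Coquelicot Require Import Coquelicot.
From mathcomp Require binomial.
Open Scope R_scope.

Definition smooth (f : R -> R) : Prop := forall n t, ex_derive_n f n t.

Definition support (f : R -> R) : R -> Prop := adherence (fun t => f t <> 0).

(* Compactness of the support is the [support] clause, [-1,1] being compact. *)
Record is_phi (phi : R -> R) : Prop := {
  phi_smooth : smooth phi;
  phi_support : forall t, support phi t <-> -1 <= t <= 1;
  phi_pos : forall t, -1 < t < 1 -> 0 < phi t;
  phi_at0 : phi 0 = 1;
  phi_deriv : forall t,
    Derive phi t = 2 * (phi (2 * t + 1) - phi (2 * t - 1))
}.

(* The binary digits of k of index i >= k all vanish, since k < 2 ^ k. *)
Definition binary_digit_sum (k : nat) : nat :=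
  list_sum (map (fun i => Nat.modulo (Nat.div k (Nat.pow 2 i)) 2) (seq 0 k)).

Definition theta (phi : R -> R) (t : R) : R :=
  Series (fun k => (-1) ^ binary_digit_sum k * phi (t - 2 * INR k - 1)).

(* Stdlib's real-valued [C n p] is 1/2 rather than 0 at n = 1, p = 2. *)
Definition binom : nat -> nat -> nat := binomial.binomial.

(* Main.v *)
Require Import Defs.
From Stdlib Require Import Reals Lra Lia List Arith.
From Coquelicot Require Import Coquelicot.
From mathcomp Require binomial.
Open Scope R_scope.

(** The signs [(-1) ^ s(k)] form the Thue-Morse sequence, determined by
    [s(2k) = s(k)] and [s(2k+1) = s(k) + 1].  Differentiating the locally finite
    sum [theta] term by term, the equation for [phi'] turns the [k]-th term into
    twice a difference of two bumps, centred at [2(2k)+1] and [2(2k+1)+1] in the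
    variable [2t]; the recursion for [s] says that the signs they carry are
    exactly those of the terms [2k] and [2k+1] of [theta (2t)].  Hence
    [theta' t = 2 theta (2t)] ([is_derive_theta]).  Iterating, each derivative of
    [theta] is a multiple of a dilate of [theta] ([Derive_n_theta]), so it is
    again differentiable, and [theta] is smooth.

    For the derivatives of [phi]: the bumps other than the first vanish at
    [t + 1] for [t <= 1], so [phi] agrees with the translate
    [fun t => theta (t + 1)] on that half-line ([theta_first_bump]).  All
    derivatives therefore agree for [t < 1], and at the endpoint [t = 1], where
    the two functions need not agree to the right, they agree by continuity. *)

(** * Binary digit sums *)

(** The number of digits read is a separate argument, so that halving [k] can
    drop one digit; [binary_digit_sum] ties it to [k] itself. *)
Definition low_digit_sum (n k : nat) : nat :=
  list_sum (map (fun i => Nat.modulo (Nat.div k (Nat.pow 2 i)) 2) (seq 0 n)).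

Lemma low_digit_sum_S n k :
  low_digit_sum (S n) k = (k mod 2 + low_digit_sum n (k / 2))%nat.
Proof.
unfold low_digit_sum.
rewrite <- cons_seq, <- seq_shift; cbn [map list_sum fold_right].
rewrite map_map, Nat.pow_0_r, Nat.div_1_r.
unfold list_sum; cbn [fold_right]; f_equal; f_equal.
apply map_ext; intros i.
now rewrite Nat.pow_succ_r', Nat.Div0.div_div.
Qed.

Lemma low_digit_sum_stable n k :
  (k <= n)%nat -> low_digit_sum n k = binary_digit_sum k.
Proof.
induction 1 as [|n Hkn IH]; [reflexivity|].
rewrite <- IH; unfold low_digit_sum.
rewrite seq_S, map_app, list_sum_app; cbn.
rewrite Nat.div_small; [cbn; lia|].
pose proof (Nat.pow_gt_lin_r 2 n); lia.
Qed.

Lemma binary_digit_sum_double k :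
  binary_digit_sum (2 * k) = binary_digit_sum k.
Proof.
rewrite <- (low_digit_sum_stable (S (2 * k)) (2 * k)) by lia.
rewrite low_digit_sum_S, low_digit_sum_stable.
- rewrite (Nat.mul_comm 2 k), Nat.Div0.mod_mul, Nat.div_mul by lia; reflexivity.
- rewrite (Nat.mul_comm 2 k), Nat.div_mul; lia.
Qed.

Lemma binary_digit_sum_double_succ k :
  binary_digit_sum (S (2 * k)) = S (binary_digit_sum k).
Proof.
rewrite <- (low_digit_sum_stable (S (2 * k)) (S (2 * k))) by lia.
rewrite low_digit_sum_S.
replace (S (2 * k)) with (1 + k * 2)%nat by lia.
rewrite Nat.Div0.mod_add, Nat.div_add, (Nat.div_small 1 2) by lia.
rewrite low_digit_sum_stable by lia; reflexivity.
Qed.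

(** * Finite sums, finite series, and agreement of continuous functions *)

Lemma sum_n_pairs (b : nat -> R) N :
  sum_n (fun k => b (2 * k)%nat + b (S (2 * k))) N = sum_n b (S (2 * N)).
Proof.
induction N as [|N IH].
- now rewrite sum_Sn, !sum_O.
- rewrite sum_Sn, IH.
  replace (S (2 * S N)) with (S (S (S (2 * N)))) by lia.
  rewrite !(sum_Sn b).
  replace (2 * S N)%nat with (S (S (2 * N))) by lia.
  unfold plus; cbn -[sum_n Nat.mul]; symmetry; apply Rplus_assoc.
Qed.

Lemma Series_finite (a : nat -> R) N :
  (forall k, (N < k)%nat -> a k = 0) -> Series a = sum_n a N.
Proof.
intros Ha; apply is_series_unique.
apply (is_lim_seq_ext_loc (fun _ => sum_n a N) (sum_n a) (sum_n a N));
  [|apply is_lim_seq_const].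
exists N; intros n Hn.
induction Hn as [|n Hn IH]; [reflexivity|].
rewrite sum_Sn, <- IH, Ha by lia.
symmetry; apply Rplus_0_r.
Qed.

(** Asking for one point of agreement in each ball, rather than agreement on a
    punctured neighbourhood, covers one-sided agreement at an endpoint. *)
Lemma continuous_eq_adherence (f g : R -> R) x :
  continuous f x -> continuous g x ->
  (forall eps : posreal, exists y, Rabs (y - x) < eps /\ f y = g y) ->
  f x = g x.
Proof.
intros Hf Hg Hnear.
apply Rminus_diag_uniq.
destruct (Req_dec (f x - g x) 0) as [E|E]; [exact E|exfalso].
assert (Hd : continuous (fun y => minus (f y) (g y)) x)
  by now apply (continuous_minus f g x).
destruct (Hd (fun z => z <> 0)) as [eps Heps].
- exists (mkposreal _ (Rabs_pos_lt _ E)); intros z Hz Hz0.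
  change (Rabs (z - (f x - g x)) < Rabs (f x - g x)) in Hz.
  rewrite Hz0, Rminus_0_l, Rabs_Ropp in Hz; lra.
- destruct (Hnear eps) as [y [Hy Efg]].
  apply (Heps y Hy); unfold minus, plus, opp; cbn; lra.
Qed.

(** * The functions phi and theta *)

Section Phi.

Variables (phi : R -> R) (Hphi : is_phi phi).

Lemma ex_derive_phi t : ex_derive phi t.
Proof. exact (phi_smooth _ Hphi 1%nat t). Qed.

Lemma is_derive_phi t :
  is_derive phi t (2 * (phi (2 * t + 1) - phi (2 * t - 1))).
Proof.
rewrite <- (phi_deriv _ Hphi t); apply Derive_correct, ex_derive_phi.
Qed.

Lemma phi_off_support t : ~ (-1 <= t <= 1) -> phi t = 0.
Proof.
intros Ht; destruct (Req_dec (phi t) 0) as [E|E]; [exact E|].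
exfalso; apply Ht, (phi_support _ Hphi).
intros V [d Hd]; exists t; split; [|exact E].
apply Hd; unfold disc; rewrite Rminus_diag, Rabs_R0; apply cond_pos.
Qed.

(** The endpoints lie in the support, but [phi] vanishes there by continuity. *)
Lemma phi_vanishes t : t <= -1 \/ 1 <= t -> phi t = 0.
Proof.
intros Ht.
apply (continuous_eq_adherence phi (fun _ => 0)).
- exact (ex_derive_continuous phi t (ex_derive_phi t)).
- apply continuous_const.
- intros [eps Heps]; cbn.
  destruct Ht as [Ht|Ht]; [exists (t - eps / 2)|exists (t + eps / 2)];
    (split; [apply Rabs_def1; lra|apply phi_off_support; lra]).
Qed.

Definition theta_term (t : R) (k : nat) : R :=
  (-1) ^ binary_digit_sum k * phi (t - 2 * INR k - 1).

Lemma theta_finite N t :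
  t <= 2 * INR N + 2 -> theta phi t = sum_n (theta_term t) N.
Proof.
intros Ht; apply Series_finite; intros k Hk.
apply le_INR in Hk; rewrite S_INR in Hk.
rewrite phi_vanishes by lra; ring.
Qed.

Lemma theta_first_bump t : t <= 1 -> theta phi (t + 1) = phi t.
Proof.
intros Ht; rewrite (theta_finite 0) by (cbn; lra).
rewrite sum_O; unfold theta_term; cbn.
rewrite Rmult_1_l; f_equal; ring.
Qed.

(** The derivative of the [k]-th bump is a pair of bumps at half the scale,
    carrying opposite signs, like the terms [2k] and [2k+1]. *)
Lemma is_derive_theta_term k t :
  is_derive (fun u => theta_term u k) t
    (2 * (theta_term (2 * t) (2 * k) + theta_term (2 * t) (S (2 * k)))).
Proof.
unfold theta_term.
rewrite binary_digit_sum_double, binary_digit_sum_double_succ.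
evar_last.
- apply is_derive_scal.
  apply (is_derive_comp phi (fun u => u - 2 * INR k - 1)).
  + apply is_derive_phi.
  + auto_derive; [exact I|reflexivity].
- rewrite S_INR, mult_INR, <- tech_pow_Rmult.
  change (INR 2) with 2; unfold scal; cbn -[pow binary_digit_sum]; unfold mult;
    cbn -[pow binary_digit_sum].
  replace (2 * t - 2 * (2 * INR k) - 1)
    with (2 * (t - 2 * INR k - 1) + 1) by ring.
  replace (2 * t - 2 * (2 * INR k + 1) - 1)
    with (2 * (t - 2 * INR k - 1) - 1) by ring.
  ring.
Qed.

Lemma is_derive_theta t : is_derive (theta phi) t (2 * theta phi (2 * t)).
Proof.
destruct (INR_unbounded t) as [N HN].
pose proof (pos_INR N).
apply (is_derive_ext_loc (fun u => sum_n (theta_term u) N)).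
- exists (mkposreal 1 Rlt_0_1); intros u Hu.
  apply Rabs_lt_between' in Hu; cbn in Hu.
  symmetry; apply theta_finite; lra.
- (* The first [N + 1] terms at [t] give the first [2N + 2] terms at [2t]. *)
  rewrite (theta_finite (S (2 * N)) (2 * t))
    by (rewrite S_INR, mult_INR; change (INR 2) with 2; lra).
  rewrite <- sum_n_pairs.
  evar_last.
  + apply (is_derive_sum_n (fun k u => theta_term u k)).
    intros k _; apply is_derive_theta_term.
  + apply (sum_n_mult_l (K := R_Ring) 2).
Qed.

Lemma is_derive_theta_dilate (a c t : R) :
  is_derive (fun u => c * theta phi (a * u)) t
    (c * (a * 2) * theta phi (2 * (a * t))).
Proof.
evar_last.
- apply is_derive_scal.
  apply (is_derive_comp (theta phi) (fun u => a * u)).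
  + apply is_derive_theta.
  + auto_derive; [exact I|reflexivity].
- unfold scal; cbn; unfold mult; cbn; ring.
Qed.

Lemma binom_triangular_S k :
  binom (S (S k)) 2 = (binom (S k) 2 + S k)%nat.
Proof. unfold binom; now rewrite binomial.binS, binomial.bin1. Qed.

Lemma Derive_n_theta k t :
  Derive_n (theta phi) k t = 2 ^ binom (S k) 2 * theta phi (2 ^ k * t).
Proof.
revert t; induction k as [|k IH]; intros t.
- change (theta phi t = 1 * theta phi (1 * t)); now rewrite !Rmult_1_l.
- cbn [Derive_n]; rewrite (Derive_ext _ _ _ IH).
  rewrite (is_derive_unique _ _ _ (is_derive_theta_dilate _ _ t)).
  rewrite binom_triangular_S, pow_add, <- !tech_pow_Rmult, Rmult_assoc.
  rewrite (Rmult_comm (2 ^ k) 2), !Rmult_assoc; reflexivity.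
Qed.

Lemma smooth_theta : smooth (theta phi).
Proof.
intros [|n] t; [exact I|].
apply (ex_derive_ext (fun u => 2 ^ binom (S n) 2 * theta phi (2 ^ n * u))).
- intros u; symmetry; apply Derive_n_theta.
- eexists; apply is_derive_theta_dilate.
Qed.

Lemma Derive_n_phi_left k t :
  t < 1 -> Derive_n phi k t = Derive_n (theta phi) k (t + 1).
Proof.
intros Ht; rewrite <- Derive_n_comp_trans.
apply Derive_n_ext_loc.
apply (filter_imp (fun u => u < 1)); [|now apply open_lt].
intros u Hu; symmetry; apply theta_first_bump; lra.
Qed.

Lemma continuous_Derive_n_smooth (f : R -> R) k t :
  smooth f -> continuous (Derive_n f k) t.
Proof. intros Hf; exact (ex_derive_continuous (Derive_n f k) t (Hf (S k) t)). Qed.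

Lemma Derive_n_phi k t :
  t <= 1 -> Derive_n phi k t = Derive_n (theta phi) k (t + 1).
Proof.
intros Ht.
apply (continuous_eq_adherence
  (Derive_n phi k) (fun u => Derive_n (theta phi) k (u + 1))).
- apply continuous_Derive_n_smooth, (phi_smooth _ Hphi).
- apply (continuous_comp (fun u => u + 1) (Derive_n (theta phi) k)).
  + apply (ex_derive_continuous (fun u => u + 1)); auto_derive; exact I.
  + apply continuous_Derive_n_smooth, smooth_theta.
- intros [eps Heps]; exists (t - eps / 2); cbn; split.
  + apply Rabs_def1; lra.
  + apply Derive_n_phi_left; lra.
Qed.

End Phi.

Theorem theorem4 (phi : R -> R) (Hphi : is_phi phi) :
  smooth (theta phi) /\
  (forall t : R, Derive (theta phi) t = 2 * theta phi (2 * t)) /\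
  (forall (t : R) (k : nat), -1 <= t <= 1 ->
     Derive_n phi k t
     = 2 ^ binom (S k) 2 * theta phi (2 ^ k * t + 2 ^ k)).
Proof.
split; [|split].
- now apply smooth_theta.
- intros t; now apply is_derive_unique, is_derive_theta.
- intros t k Ht.
  rewrite Derive_n_phi, Derive_n_theta by (exact Hphi || lra).
  now rewrite Rmult_plus_distr_l, Rmult_1_r.
Qed.
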